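(* Let $G=(V,E)$ be a graph. The OD-hypergraph $\mathcal{H}_{\rm OD}(G)=(V,\mathcal{F}_{\rm OD})$ of $G$ is composed of - the closed neighborhoods $N[v]$ of all vertices $v\in V$, and - the symmetric differences $N(u)\,\Delta\, N(v)$ of open neighborhoods of distinct vertices $u,v\in V$ as hyperedges in $\mathcal{F}_{\rm OD}$ (that is, with this $\mathcal{F}_{\rm OD}$, a set $C\subseteq V$ is an OD-code of $G$ if and only if $C\cap F\neq\emptyset$ for all $F\in\mathcal{F}_{\rm OD}$), and $\gamma^{\rm OD}(G)=\tau(\mathcal{H}_{\rm OD}(G))$ holds.
   Context: Graphs are finite, simple and undirected. For a vertex $v$ of $G=(V,E)$, $N(v)=\{u\in V: uv\in E\}$ and $N[v]=N(v)\cup\{v\}$. An OD-code of $G$ is a set $C\subseteq V$ with $N[v]\cap C\neq\emptyset$ for all $v\in V$ and $N(u)\cap C\neq N(v)\cap C$ for all distinct $u,v\in V$. $\gamma^{\rm OD}(G)$ is the minimum cardinality of an OD-code of $G$. $A\,\Delta\,B=(A\setminus B)\cup(B\setminus A)$. A cover of a hypergraph $(V,\mathcal{F})$ is a set $C\subseteq V$ with $C\cap F\neq\emptyset$ for all $F\in\mathcal{F}$; the covering number $\tau$ is the minimum cardinality of a cover. The OD-hypergraph of $G$ is a hypergraph on $V$ whose covers are exactly the OD-codes of $G$. (The numbers $\gamma^{\rm OD}(G)$ and $\tau$ are defined only when codes, respectively covers, exist.) *)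

(* Defs.v *)
From mathcomp Require Import all_boot.

Set Implicit Arguments.
Unset Strict Implicit.
Unset Printing Implicit Defensive.

Record sgraph := SGraph {
  vertex :> finType;
  adj : rel vertex;
  adj_sym : symmetric adj;
  adj_irrefl : irreflexive adj
}.

Definition open_nbh (G : sgraph) (v : G) : {set G} := [set u | adj u v].

Definition closed_nbh (G : sgraph) (v : G) : {set G} := v |: open_nbh v.

Definition symdiff (T : finType) (A B : {set T}) : {set T} :=
  (A :\: B) :|: (B :\: A).

(* Minimum cardinality of a set satisfying P, as a partial quantity: it is
   None exactly when no set satisfies P. Equality of two such minima thus says
   that they are defined simultaneously and, when defined, agree. *)
Definition min_card (T : finType) (P : pred {set T}) : option nat :=
  if [pick C : {set T} | P C] is Some C0
  then Some #|[arg min_(C < C0 | P C) #|C|]|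
  else None.

Definition OD_code (G : sgraph) (C : {set G}) : bool :=
  [forall v : G, closed_nbh v :&: C != set0] &&
  [forall u : G, forall v : G,
     (u != v) ==> (open_nbh u :&: C != open_nbh v :&: C)].

Definition gamma_OD (G : sgraph) : option nat := min_card (@OD_code G).

(* The empty set is allowed as a hyperedge; there is then no cover. *)
Record hypergraph (V : finType) := Hypergraph {
  hyperedges : {set {set V}}
}.

Definition hcover (V : finType) (H : hypergraph V) (C : {set V}) : bool :=
  [forall F in hyperedges H, C :&: F != set0].

Definition tau (V : finType) (H : hypergraph V) : option nat :=
  min_card (hcover H).

Definition OD_hypergraph (G : sgraph) : hypergraph G :=
  Hypergraph
    ([set closed_nbh v | v : G] :|:
     [set symdiff (open_nbh u) (open_nbh v) | u in [set: G], v in [set: G] & u != v]).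

(* Main.v *)
Require Import Defs.
From mathcomp Require Import all_boot.

(** Intersection distributes over symmetric difference, and a symmetric difference is empty only for
    equal sets. Hence [C] meets N(u) Δ N(v) exactly when it separates [u] from [v]
    ([meets_symdiff]), while meeting all closed neighborhoods is domination; so covers and OD-codes
    coincide ([OD_codeE]), and their minima agree ([eq_min_card]). *)

Lemma symdiff_eq0 (T : finType) (A B : {set T}) :
  (symdiff A B == set0) = (A == B).
Proof. by rewrite /symdiff setU_eq0 !setD_eq0 eqEsubset. Qed.

Lemma setI_symdiff (T : finType) (A B C : {set T}) :
  C :&: symdiff A B = symdiff (A :&: C) (B :&: C).
Proof.
apply/setP => x; rewrite !inE.
by case: (x \in A); case: (x \in B); case: (x \in C).
Qed.

Lemma meets_symdiff (T : finType) (A B C : {set T}) :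
  (C :&: symdiff A B != set0) = (A :&: C != B :&: C).
Proof. by rewrite setI_symdiff symdiff_eq0. Qed.

Lemma eq_min_card (T : finType) (P Q : pred {set T}) :
  P =1 Q -> min_card P = min_card Q.
Proof.
(* Both sides now pick the same [C0], or both are [None]. *)
move=> eqPQ; rewrite /min_card -(eq_pick eqPQ).
case: pickP => [C0 PC0|//]; congr Some.
case: arg_minnP => // A PA minA.
case: arg_minnP => [|B QB minB]; first by rewrite -eqPQ.
(* The minimizers [A] and [B] need not be compared as sets: each satisfies both predicates, so each
   cardinality bounds the other. *)
by apply/eqP; rewrite eqn_leq minA ?eqPQ // minB // -eqPQ.
Qed.

Lemma OD_codeE (G : sgraph) (C : {set G}) :
  OD_code C = hcover (OD_hypergraph G) C.
Proof.
apply/andP/forall_inP => [[/forallP domC /forallP sepC] F | covC].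
  case/setUP => [/imsetP[v _ ->] | /imset2P[u v _]]; first by rewrite setIC.
  rewrite inE => /andP[_ neq_uv] ->; rewrite meets_symdiff.
  by have /forallP/(_ v)/implyP := sepC u; apply.
split; first by apply/forallP => v; rewrite setIC covC // inE imset_f.
apply/forallP => u; apply/forallP => v; apply/implyP => neq_uv.
rewrite -meets_symdiff covC // inE; apply/orP; right.
by apply: imset2_f; rewrite ?inE.
Qed.

Theorem corollary1 (G : sgraph) :
  (forall C : {set G}, OD_code C <-> hcover (OD_hypergraph G) C) /\
  gamma_OD G = tau (OD_hypergraph G).
Proof.
split; first by move=> C; rewrite OD_codeE.
by apply: eq_min_card => C; apply: OD_codeE.
Qed.
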